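(* (Riesz lemma) Let $A_2$ be a von Neumann algebra and let $\mathcal E=(E,\mathcal H_1,(\pi_2,\mathcal H_2))$ be a Hilbert von Neumann $A_2$-module. Suppose $f:E\to[E^*E]$ is linear, satisfies $f(xz)=f(x)z$ for all $x\in E$ and $z\in[E^*E]$, and is bounded, i.e. there is $K>0$ with $\|f(x)\|\le K\|x\|$ for all $x\in E$. Then there exists $y\in E$ such that $f(x)=y^*x$ for all $x\in E$.
   Context: All Hilbert spaces are complex and separable. $\mathcal L(\mathcal H,\mathcal K)$ is the set of bounded operators from $\mathcal H$ to $\mathcal K$. For a set $E$ of operators, $[E]$ denotes the closure, in the weak operator topology (WOT), of its linear span; $EF=\{xy: x\in E,y\in F\}$ and $E^*=\{x^*:x\in E\}$. A (1,2) von Neumann corner is a triple $(E,\mathcal H_1,\mathcal H_2)$ with $E\subset\mathcal L(\mathcal H_2,\mathcal H_1)$ such that $E=[E]\supset EE^*E$; then $[E^*E]\subset\mathcal L(\mathcal H_2)$ is a WOT-closed $*$-algebra having an identity (a projection, possibly not $1_{\mathcal H_2}$). A Hilbert von Neumann $A_2$-module is a tuple $(E,\mathcal H_1,(\pi_2,\mathcal H_2))$ where $(E,\mathcal H_1,\mathcal H_2)$ is a (1,2) von Neumann corner and $\pi_2:A_2\to[E^*E]$ is a normal ($*$-)isomorphism onto $[E^*E]$. Norms are operator norms. *)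

(* Defs.v *)
From HB Require Import structures.
From mathcomp Require Import all_boot all_order all_algebra sesquilinear.
From mathcomp Require Import all_classical all_reals all_analysis.
From mathcomp Require Export complex.

Set Implicit Arguments.
Unset Strict Implicit.
Unset Printing Implicit Defensive.

Import Order.TTheory GRing.Theory Num.Theory numFieldNormedType.Exports.

Local Open Scope classical_set_scope.
Local Open Scope ring_scope.

(* Complex separable Hilbert spaces; the inner product is linear in its first
   argument and conjugate-linear in the second. *)
HB.mixin Record CompleteNormedModule_isHilbert (R : realType) H
    & CompleteNormedModule R[i] H := {
  inner : {dot H for (@Num.conj R[i])};
  inner_normE : forall u : H, inner u u = `|u| ^+ 2;
  hilbert_separable : exists2 S : set H, countable S & dense S
}.

#[short(type="hilbertType")]
HB.structure Definition Hilbert (R : realType) :=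
  {H of CompleteNormedModule R[i] H & CompleteNormedModule_isHilbert R H}.

Arguments inner {R s}.

Section BoundedOperators.
Variables (R : realType) (H K : hilbertType R).

Definition bounded_linear : {pred H -> K} := fun f =>
  `[< linear f /\ exists M : R[i], forall u, `|f u| <= M * `|u| >].

Lemma bounded_linear_submod_closed : submod_closed bounded_linear.
Proof.
split.
  apply/asboolP; split=> [a u v|]; first by rewrite /= scaler0 addr0.
  by exists 0 => u; rewrite normr0 mul0r.
move=> c f g /asboolP[fl [M fM]] /asboolP[gl [N gN]]; apply/asboolP; split.
  move=> a u v; rewrite !fctE fl gl !scalerDr !scalerA (mulrC c) -!addrA.
  by congr (_ + _); rewrite addrCA.
exists (`|c| * M + N) => u; rewrite mulrDl (le_trans (ler_normD _ _))//.
by rewrite lerD// normrZ -mulrA ler_wpM2l.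
Qed.

HB.instance Definition _ := GRing.isSubmodClosed.Build R[i] (H -> K)
  bounded_linear bounded_linear_submod_closed.

Record bounded_op := BoundedOp {
  bounded_op_fun :> H -> K;
  bounded_opP : bounded_op_fun \in bounded_linear
}.

HB.instance Definition _ := [isSub for bounded_op_fun].
HB.instance Definition _ := [Choice of bounded_op by <:].
HB.instance Definition _ := [SubChoice_isSubLmodule of bounded_op by <:].

End BoundedOperators.

Notation "''L' ( H , K )" := (bounded_op H K)
  (at level 8, format "''L' ( H ,  K )") : type_scope.

Section Composition.
Variable R : realType.

Lemma bounded_linear_id (H : hilbertType R) :
  (idfun : H -> H) \in @bounded_linear R H H.
Proof. by apply/asboolP; split=> //; exists 1 => u; rewrite mul1r. Qed.

Definition op1 (H : hilbertType R) : 'L(H, H) :=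
  BoundedOp (bounded_linear_id H).

Lemma bounded_linear_comp (H K G : hilbertType R)
    (x : 'L(K, G)) (y : 'L(H, K)) :
  ((x : K -> G) \o y) \in @bounded_linear R H G.
Proof.
case: x y => f /asboolP[fl [M fM]] [g /asboolP[gl [N gN]]] /=.
apply/asboolP; split=> [a u v|]; first by rewrite /= gl fl.
exists (`|M| * `|N|) => u /=; rewrite (le_trans (fM _))//.
have [g0|g0] := eqVneq (g u) 0; first by rewrite g0 normr0 mulr0 !mulr_ge0.
have MR : 0 <= M.
  by rewrite -(@pmulr_lge0 _ `|g u|) ?normr_gt0//; exact: le_trans (fM _).
have u0 : 0 < `|u|.
  rewrite normr_gt0; apply: contraNneq g0 => ->.
  by rewrite -normr_le0 (le_trans (gN _))// normr0 mulr0.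
have NR : 0 <= N by rewrite -(pmulr_lge0 _ u0); exact: le_trans (gN _).
by rewrite !ger0_norm// -mulrA ler_wpM2l.
Qed.

Definition op_comp (H K G : hilbertType R) (x : 'L(K, G)) (y : 'L(H, K)) :
  'L(H, G) := BoundedOp (bounded_linear_comp x y).

End Composition.

Notation "x \oL y" := (op_comp x y) (at level 40, left associativity).

Section OperatorNotions.
Variable R : realType.
Implicit Types H K G : hilbertType R.

Definition opnorm H K (x : 'L(H, K)) : R :=
  sup [set complex.Re `|x u| | u in [set u : H | `|u| <= 1]].

(* The y below exists by the Riesz representation theorem and is unique; the
   default value 0 of xget is never used. *)
Definition adj H K (x : 'L(H, K)) : 'L(K, H) :=
  xget 0 [set y : 'L(K, H) | forall u v, inner (x u) v = inner u (y v)].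

Definition wot_coef H K (x : 'L(H, K)) :
    prod_topology (fun _ : H * K => (R[i]^o : topologicalType)) :=
  fun p => inner (x p.1) p.2.

Definition wot H K : topologicalType := initial_topology (@wot_coef H K).

Definition lspan (V : lmodType R[i]) (S : set V) : set V :=
  [set x | exists n (c : 'I_n -> R[i]) (e : 'I_n -> V),
     (forall i, S (e i)) /\ x = \sum_(i < n) c i *: e i].

Definition wot_span H K (E : set 'L(H, K)) : set 'L(H, K) :=
  @closure (wot H K) (lspan E).

Definition set_comp H K G (E : set 'L(K, G)) (F : set 'L(H, K)) :
    set 'L(H, G) :=
  [set x \oL y | x in E & y in F].

Definition set_adj H K (E : set 'L(H, K)) : set 'L(K, H) := [set adj x | x in E].

(* [E^* E] *)
Definition corner_alg H1 H2 (E : set 'L(H2, H1)) : set 'L(H2, H2) :=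
  wot_span (set_comp (set_adj E) E).

Definition von_neumann_algebra H (A : set 'L(H, H)) : Prop :=
  [/\ wot_span A = A, set_comp A A `<=` A, set_adj A `<=` A & A (op1 H)].

Definition vn_corner H1 H2 (E : set 'L(H2, H1)) : Prop :=
  E = wot_span E /\ set_comp (set_comp E (set_adj E)) E `<=` E.

Definition self_adjoint H (x : 'L(H, H)) : Prop := adj x = x.

Definition op_le H (x y : 'L(H, H)) : Prop :=
  forall u, inner (x u) u <= inner (y u) u.

Definition directed_sa H (D : set 'L(H, H)) : Prop :=
  [/\ D !=set0, D `<=` @self_adjoint H &
      forall x y, D x -> D y -> exists z, [/\ D z, op_le x z & op_le y z]].

(* a is the supremum of D in the self-adjoint part of A *)
Definition is_sup_in H (A D : set 'L(H, H)) (a : 'L(H, H)) : Prop :=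
  [/\ A a, self_adjoint a, forall x, D x -> op_le x a &
      forall b, A b -> self_adjoint b -> (forall x, D x -> op_le x b) ->
        op_le a b].

Definition linear_on (V W : lmodType R[i]) (S : set V) (f : V -> W) : Prop :=
  forall (c : R[i]) x y, S x -> S y -> f (c *: x + y) = c *: f x + f y.

(* Only the values of pi on A matter. *)
Definition star_isomorphism H K (A : set 'L(H, H)) (B : set 'L(K, K))
    (pi : 'L(H, H) -> 'L(K, K)) : Prop :=
  [/\ set_bij A B pi,
      linear_on A pi,
      forall x y, A x -> A y -> pi (x \oL y) = pi x \oL pi y &
      forall x, A x -> pi (adj x) = adj (pi x)].

Definition normal_map H K (A : set 'L(H, H)) (B : set 'L(K, K))
    (pi : 'L(H, H) -> 'L(K, K)) : Prop :=
  forall D a, D `<=` A -> directed_sa D -> is_sup_in A D a ->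
    is_sup_in B (pi @` D) (pi a).

Definition hilbert_vn_module K H1 H2 (A2 : set 'L(K, K))
    (E : set 'L(H2, H1)) (pi2 : 'L(K, K) -> 'L(H2, H2)) : Prop :=
  [/\ vn_corner E, star_isomorphism A2 (corner_alg E) pi2 &
      normal_map A2 (corner_alg E) pi2].

End OperatorNotions.

(* Main.v *)
Require Import Defs.
From mathcomp Require Import all_boot all_order all_algebra.
From mathcomp Require Import all_classical all_reals all_analysis.
From mathcomp Require Import ring lra.

(** An operator y in E takes its values in the closed span of E H2, so
    f(x) = y^* x determines it through <x v, y w> = <f(x) v, w>: it has to be the
    adjoint of the operator x v |-> f(x) v on the span of E H2, extended by zero.
    What has to be shown is that this operator is well defined and bounded, that
    is |sum f(x_i) v_i| <= M |sum x_i v_i| for some M, and that y belongs to E.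

    Both follow from an approximate unit.  For x_1, ..., x_n in E let h be a
    small multiple of sum x_i x_i^*, so that 0 <= h <= 1.  The operators
    u_m = 1 - (1 - h)^m are polynomials in h without constant term, they have
    norm at most 2, and u_m x_i tends to x_i in norm because
    |x_i^* (1 - h)^m v|^2 is at most a constant times
    <h (1 - h)^m v, (1 - h)^m v>, whose m-fold multiple is bounded by |v|^2:
    the terms decrease with m and are dominated by a telescoping series
    (lemma [compl_pow_decay]).  Since f(x x^* z) = f(x) x^* z, the map
    z |-> f(u_m z) has the form z |-> e^* z with e in E: it is built from the
    operators x_i f(x_i)^*, and E [E^* E]^* is contained in E
    (lemma [corner_comp_adj]).  Moreover
    |e|^2 = |e^* e| = |f(u_m e)| <= 2 K |e|, so |e| <= 2 K uniformly in the
    family x_1, ..., x_n (lemma [represented_norm_le]).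

    Hence f is a pointwise limit of maps z |-> e^* z with e in E and |e| <= 2 K.
    The norm bound above holds with M = 2 K because |e^*| <= 2 K, and the
    operators e converge weakly to y: they are bounded, all of them take
    values in the closed span of E H2, and <e v, x w> = <v, e^* x w> tends to
    <v, f(x) w> = <y v, x w>.  As E is weakly closed, y belongs to E.

    The adjoint of an operator, the orthogonal projection onto the closed span
    of E H2 and the operator y are all instances of one statement, the existence
    of the adjoint of a bounded linear relation (theorem [relation_adjoint]),
    proved by minimising a quadratic functional. *)

Set Implicit Arguments.
Unset Strict Implicit.
Unset Printing Implicit Defensive.

Import Order.TTheory GRing.Theory Num.Theory numFieldNormedType.Exports.

Local Open Scope classical_set_scope.
Local Open Scope ring_scope.

(** * The real inner product of a complex Hilbert space *)

Section InnerProduct.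
Context {R : realType} {H : hilbertType R}.
Implicit Types (u v w : H) (c : R[i]) (t : R).

Definition vnorm u : R := complex.Re `|u|.

(** The inner product with values in the plain type R[i], to which the ring and
    order operations of complex numbers apply directly. *)
Definition ip u v : R[i] := inner u v.

(** Norm estimates, uniqueness of representing vectors and the weak operator
    topology only depend on real parts, which can be compared in R. *)
Definition rinner u v : R := complex.Re (ip u v).

Lemma ip_normE u : ip u u = `|u| ^+ 2.
Proof. exact: inner_normE. Qed.

Lemma ipC u v : ip u v = Num.conj (ip v u).
Proof. by rewrite /ip hermC expr0 mul1r. Qed.

Lemma ipDl u v w : ip (u + v) w = ip u w + ip v w.
Proof. exact: linearDl. Qed.

Lemma ipZl c u v : ip (c *: u) v = c * ip u v.
Proof. exact: linearZl_LR. Qed.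

Lemma ipZr c u v : ip u (c *: v) = Num.conj c * ip u v.
Proof. exact: linearZr. Qed.

Lemma ReD (a b : R[i]) : complex.Re (a + b) = complex.Re a + complex.Re b.
Proof. by case: a b => ? ? [? ?]. Qed.

Lemma ReM_real t (a : R[i]) : complex.Re (t%:C%C * a) = t * complex.Re a.
Proof. by case: a => ? ? /=; rewrite mul0r subr0. Qed.

Lemma normE u : `|u| = (vnorm u)%:C%C.
Proof. by rewrite /vnorm RRe_real// ger0_real. Qed.

Lemma vnorm_ge0 u : 0 <= vnorm u.
Proof. by rewrite -ler0c -normE. Qed.

Lemma vnormD u v : vnorm (u + v) <= vnorm u + vnorm v.
Proof. by rewrite -lecR rmorphD /= -!normE ler_normD. Qed.

Lemma vnormN u : vnorm (- u) = vnorm u.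
Proof. by rewrite /vnorm normrN. Qed.

Lemma vnormZ c u : vnorm (c *: u) = complex.Re `|c| * vnorm u.
Proof.
rewrite /vnorm normrZ -[in LHS](@RRe_real _ `|c|) ?ReM_real//.
Qed.

Lemma vnorm0 : vnorm (0 : H) = 0.
Proof. by rewrite /vnorm normr0. Qed.

Lemma vnorm0_eq0 u : vnorm u = 0 -> u = 0.
Proof. by move=> u0; apply/eqP; rewrite -normr_eq0 normE u0. Qed.

Lemma rinner_self u : rinner u u = vnorm u ^+ 2.
Proof. by rewrite /rinner ip_normE normE -rmorphXn. Qed.

Lemma rinnerC u v : rinner u v = rinner v u.
Proof. by rewrite /rinner ipC; case: (ip v u). Qed.

Lemma rinnerDl u v w : rinner (u + v) w = rinner u w + rinner v w.
Proof. by rewrite /rinner ipDl ReD. Qed.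

Lemma rinnerZl t u v : rinner (t%:C%C *: u) v = t * rinner u v.
Proof. by rewrite /rinner ipZl ReM_real. Qed.

Lemma rinnerZr_conj c u v : rinner u (c *: v) = rinner (Num.conj c *: u) v.
Proof. by rewrite /rinner ipZl ipZr. Qed.

Lemma rinnerNl u v : rinner (- u) v = - rinner u v.
Proof.
have -> : - u = (-1)%:C%C *: u by rewrite rmorphN1 scaleN1r.
by rewrite rinnerZl mulN1r.
Qed.

Lemma rinnerBl u v w : rinner (u - v) w = rinner u w - rinner v w.
Proof. by rewrite rinnerDl rinnerNl. Qed.

Lemma rinnerDr u v w : rinner u (v + w) = rinner u v + rinner u w.
Proof. by rewrite !(rinnerC u) rinnerDl. Qed.

Lemma rinnerBr u v w : rinner u (v - w) = rinner u v - rinner u w.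
Proof. by rewrite !(rinnerC u) rinnerBl. Qed.

Lemma rinnerZr t u v : rinner u (t%:C%C *: v) = t * rinner u v.
Proof. by rewrite !(rinnerC u) rinnerZl. Qed.

Lemma rinner0r u : rinner u 0 = 0.
Proof. by rewrite -(scale0r u) -[X in X *: _]/(0%:C%C) rinnerZr mul0r. Qed.

Lemma rinner0l u : rinner 0 u = 0.
Proof. by rewrite rinnerC rinner0r. Qed.

Lemma vnormD_sqr u v :
  vnorm (u + v) ^+ 2 = vnorm u ^+ 2 + 2 * rinner u v + vnorm v ^+ 2.
Proof. by rewrite -!rinner_self rinnerDl !rinnerDr (rinnerC v u); ring. Qed.

Lemma vnormB_sqr u v :
  vnorm (u - v) ^+ 2 = vnorm u ^+ 2 - 2 * rinner u v + vnorm v ^+ 2.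
Proof. by rewrite -!rinner_self rinnerBl !rinnerBr (rinnerC v u); ring. Qed.

Lemma rinner_le u v : rinner u v <= vnorm u * vnorm v.
Proof.
have [/vnorm0_eq0 ->|u0] := eqVneq (vnorm u) 0.
  by rewrite rinner0l vnorm0 mul0r.
have [/vnorm0_eq0 ->|v0] := eqVneq (vnorm v) 0.
  by rewrite rinner0r vnorm0 mulr0.
have {}u0 : 0 < vnorm u by rewrite lt_def u0 vnorm_ge0.
have {}v0 : 0 < vnorm v by rewrite lt_def v0 vnorm_ge0.
have := sqr_ge0 (vnorm ((vnorm v)%:C%C *: u - (vnorm u)%:C%C *: v)).
rewrite vnormB_sqr -!rinner_self !(rinnerZl, rinnerZr) !rinner_self => h.
rewrite -(ler_pM2l (mulr_gt0 u0 v0)); nra.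
Qed.

Lemma norm_rinner_le u v : `|rinner u v| <= vnorm u * vnorm v.
Proof.
rewrite ler_norml rinner_le andbT lerNl -rinnerNl -(vnormN u).
exact: rinner_le.
Qed.

Lemma rinner_eqP u v : (forall w, rinner w u = rinner w v) -> u = v.
Proof.
move=> uv; apply/eqP; rewrite -subr_eq0; apply/eqP/vnorm0_eq0/eqP.
by rewrite -sqrf_eq0 -rinner_self rinnerBr uv subrr.
Qed.

(** For the closure under linear combinations of sets defined by approximation. *)
Lemma vnorm_comb_small c (e : R) : 0 < e -> exists2 d : R, 0 < d &
  forall u v, vnorm u <= d -> vnorm v <= d -> vnorm (c *: u + v) <= e.
Proof.
move=> e0; pose k := complex.Re `|c|.
have k0 : 0 <= k by rewrite -ler0c RRe_real// ger0_real.
have d0 : 0 < e / (k + 1) by rewrite divr_gt0// ltr_wpDl.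
exists (e / (k + 1)) => // u v ud vd.
rewrite (le_trans (vnormD _ _))// vnormZ.
have -> : e = k * (e / (k + 1)) + e / (k + 1).
  by field; rewrite gt_eqF// ltr_wpDl.
by rewrite lerD// ler_wpM2l.
Qed.

End InnerProduct.

Section RealAdjoint.
Context {R : realType} {H K : hilbertType R}.

(** Replacing u by iu turns the real part of the inner product into its
    imaginary part, so it is enough to compare real parts. *)
Lemma ip_of_rinner (x : H -> K) (y : K -> H) (u : H) (v : K) :
  (forall c, x (c *: u) = c *: x u) ->
  (forall u, rinner (x u) v = rinner u (y v)) ->
  ip (x u) v = ip u (y v).
Proof.
move=> xZ xy; have := xy ('i%C *: u); have := xy u.
rewrite xZ /rinner !ipZl /=.
move: (ip (x u) v) (ip u (y v)) => [a b] [a' b'] /= ->.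
rewrite !mul0r !sub0r !mul1r => h; congr (_ +i* _)%C.
exact: oppr_inj.
Qed.
End RealAdjoint.

(** * Bounded linear relations between Hilbert spaces *)

Lemma le_of_le_eps {R : realType} (x y B : R) :
  0 <= B -> (forall e, 0 < e -> x <= y + e * B) -> x <= y.
Proof.
move=> B0 h; apply/ler_addgt0Pr => e e0.
have B1 : 0 < B + 1 by rewrite ltr_wpDl.
apply: le_trans (h (e / (B + 1)) (divr_gt0 e0 B1)) _.
rewrite lerD2l -mulrA ler_piMr ?(ltW e0)// mulrC ler_pdivrMr// mul1r.
by rewrite lerDl.
Qed.

Lemma gt0_complex_real {R : realType} (e : R[i]) :
  0 < e -> exists2 r : R, 0 < r & e = r%:C%C.
Proof.
move=> e0; exists (complex.Re e); last by rewrite RRe_real// gtr0_real.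
by rewrite -ltcR RRe_real// gtr0_real.
Qed.

Lemma hilbert_complete {R : realType} {H : hilbertType R} (u : nat -> H) :
  (forall e : R, 0 < e ->
    exists N, forall m n, (N <= m)%N -> (N <= n)%N -> vnorm (u m - u n) < e) ->
  exists l, forall e : R, 0 < e ->
    exists N, forall n, (N <= n)%N -> vnorm (l - u n) < e.
Proof.
move=> uC.
have /cauchy_cvgP/cvg_ex[l ul] : cauchy (u @ \oo).
  apply/cauchy_exP => e /gt0_complex_real[r r0 ->].
  have [N uN] := uC _ r0; exists (u N); exists N => // n /= Nn.
  by rewrite -ball_normE /ball_/= normE ltcR uN.
exists l => e e0.
have ec0 : 0 < (e%:C%C : R[i]) by rewrite ltcR.
have /cvgrPdist_lt/(_ _ ec0)[N _ lN] := ul.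
by exists N => n /lN /=; rewrite normE ltcR.
Qed.

Section LinearRelation.
Context {R : realType}.

Definition lin_subspace (V : lmodType R[i]) (W : set V) :=
  W 0 /\ forall c a b, W a -> W b -> W (c *: a + b).

Lemma lin_subspaceZ (V : lmodType R[i]) (W : set V) c a :
  lin_subspace W -> W a -> W (c *: a).
Proof. by move=> [W0 WD] Wa; rewrite -[_ *: _]addr0; exact: WD. Qed.

Lemma lin_subspaceD (V : lmodType R[i]) (W : set V) a b :
  lin_subspace W -> W a -> W b -> W (a + b).
Proof. by move=> [W0 WD] Wa Wb; rewrite -[a]scale1r; exact: WD. Qed.

Context {H K : hilbertType R}.

(** [l] is the value at [v] of the adjoint of the relation [W]: it represents the
    functional w.1 |-> <w.2, v>.  Membership in the closure of the first
    projection of [W] makes it unique. *)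
Definition represents (W : set (H * K)) (v : K) (l : H) :=
  (forall w, W w -> rinner w.1 l = rinner w.2 v) /\
  (forall e : R, 0 < e -> exists2 w, W w & vnorm (l - w.1) <= e).

(** The representing vector is the limit of the first components of a sequence in
    [W] that minimises q(w) = |w.1|^2 - 2 Re <w.2, v>.  The parallelogram identity
    makes such a sequence Cauchy, and the Euler-Lagrange equation at the limit is
    the representation property. *)
Lemma represents_exists (W : set (H * K)) (M : R) (v : K) :
  lin_subspace W -> (forall w, W w -> vnorm w.2 <= M * vnorm w.1) ->
  exists l, represents W v l.
Proof.
move=> sW WM.
pose q (w : H * K) : R := vnorm w.1 ^+ 2 - 2 * rinner w.2 v.
have qinf : has_inf (q @` W).
  split; first by exists (q 0), 0 => //; have [] := sW.
  exists (- (M * vnorm v) ^+ 2) => _ [w Ww <-]; rewrite /q.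
  have := rinner_le w.2 v; have := WM _ Ww.
  have := vnorm_ge0 v; have := vnorm_ge0 w.1.
  move: (vnorm w.1) (vnorm w.2) (vnorm v) (rinner _ _) => a b c d a0 c0 bM dbc.
  have dM : d <= M * a * c by apply: le_trans dbc _; rewrite ler_wpM2r.
  have := sqr_ge0 (a - M * c); nra.
set d := inf (q @` W).
have dq w : W w -> d <= q w.
  by move=> Ww; apply: ge_inf; [case: qinf|exists w].
have /choice[a aP] : forall n : nat, exists w, W w /\ q w < d + n.+1%:R^-1.
  move=> n; have n0 : 0 < n.+1%:R^-1 :> R by rewrite invr_gt0.
  by have [_ [w Ww <-] qw] := inf_adherent n0 qinf; exists w.
have tend (e : R) : 0 < e -> exists N, forall n, (N <= n)%N -> n.+1%:R^-1 < e.
  move=> e0; have [N _ Ne] := near_infty_natSinv_lt (PosNum e0).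
  by exists N => n /Ne.
have /hilbert_complete[l al] : forall e : R, 0 < e -> exists N, forall m n,
    (N <= m)%N -> (N <= n)%N -> vnorm ((a m).1 - (a n).1) < e.
  move=> e e0; have e4 : 0 < e ^+ 2 / 4 by rewrite divr_gt0// exprn_gt0.
  have [N Ne] := tend _ e4; exists N => m n /Ne me /Ne ne.
  have [[Wm qm] [Wn qn]] := (aP m, aP n).
  have := dq _ (lin_subspaceZ (2^-1 : R)%:C%C sW (lin_subspaceD sW Wm Wn)).
  rewrite -(@ltr_pXn2r _ 2)// ?nnegrE ?vnorm_ge0 ?(ltW e0)//.
  move: qm qn; rewrite /q /= -!rinner_self rinnerZl rinnerZr !rinnerZl.
  rewrite !(rinnerBl, rinnerBr, rinnerDl, rinnerDr) (rinnerC (a n).1 (a m).1).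
  move: (rinner _ _) (rinner _ _) (rinner _ _) (rinner _ _) (rinner _ _).
  move: (m.+1%:R^-1) (n.+1%:R^-1) (e ^+ 2) me ne.
  by move=> *; lra.
exists l; split=> [w Ww|e /al[N /(_ _ (leqnn _))lN]]; last first.
  by exists (a N); [case: (aP N)|exact: ltW].
(* half of the derivative of q at the minimum in the direction w *)
pose g := rinner w.1 l - rinner w.2 v.
have gt t : 0 <= 2 * t * g + t ^+ 2 * vnorm w.1 ^+ 2.
  apply: (@le_of_le_eps R _ _ (1 + 2 * vnorm (t%:C%C *: w.1))).
    by rewrite addr_ge0// mulr_ge0 ?vnorm_ge0.
  move=> e e0; have [[N1 aN1] [N2 lN2]] := (tend _ e0, al _ e0).
  pose n := maxn N1 N2.
  have := aN1 n (leq_maxl _ _); have := lN2 n (leq_maxr _ _).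
  have [Wn qn] := aP n.
  have := dq _ (lin_subspaceD sW (lin_subspaceZ t%:C%C sW Ww) Wn).
  have := rinner_le (t%:C%C *: w.1) ((a n).1 - l).
  have := vnorm_ge0 (t%:C%C *: w.1).
  rewrite -(vnormN (l - _)) opprB.
  move: qn; rewrite /q /g /= vnormD_sqr -[vnorm (_ *: w.1) ^+ 2]rinner_self.
  rewrite !(rinnerDl, rinnerZl, rinnerZr) rinnerBr rinner_self.
  move: (vnorm (_ *: _)) (vnorm (_ - _)) => B s.
  move: (n.+1%:R^-1) => r qn B0 h1 h2 se ne.
  have : B * s <= B * e by rewrite ler_wpM2l// ltW.
  lra.
have N0 : 0 <= vnorm w.1 ^+ 2 by rewrite exprn_ge0// vnorm_ge0.
suff : g = 0 by move/eqP; rewrite subr_eq0 => /eqP.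
(* this step nearly minimises the quadratic polynomial of [gt]; adding 1 to the
   leading coefficient covers the case w.1 = 0 *)
have := gt (- g / (vnorm w.1 ^+ 2 + 1)).
move: (vnorm w.1 ^+ 2) N0 => N N0.
have N1 : 0 < N + 1 by lra.
have -> : 2 * (- g / (N + 1)) * g + (- g / (N + 1)) ^+ 2 * N =
    - (g ^+ 2 * (N + 2)) / (N + 1) ^+ 2 by field; rewrite gt_eqF.
rewrite pmulr_lge0 ?invr_gt0 ?exprn_gt0// oppr_ge0 pmulr_lle0; last by lra.
by move=> h; apply/eqP; rewrite -sqrf_eq0 eq_le h sqr_ge0.
Qed.

Lemma represents_le (W : set (H * K)) (M : R) v l :
  0 <= M -> (forall w, W w -> vnorm w.2 <= M * vnorm w.1) ->
  represents W v l -> vnorm l <= M * vnorm v.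
Proof.
move=> M0 WM [lW lcl].
have [/vnorm0_eq0 ->|l0] := eqVneq (vnorm l) 0.
  by rewrite vnorm0 mulr_ge0// vnorm_ge0.
have {}l0 : 0 < vnorm l by rewrite lt_def l0 vnorm_ge0.
rewrite -(ler_pM2r l0) -expr2.
apply: (@le_of_le_eps R _ _ (M * vnorm v + vnorm l)).
  by rewrite addr_ge0 ?mulr_ge0 ?vnorm_ge0.
move=> e /lcl[w Ww lw].
have := rinner_le (l - w.1) l; rewrite rinnerBl lW// rinner_self.
have := rinner_le w.2 v; have := WM _ Ww.
have : vnorm w.1 <= vnorm l + e.
  rewrite -[w.1](subrK l) addrC (le_trans (vnormD _ _))// lerD2l.
  by rewrite -vnormN opprB.
have := vnorm_ge0 v; have := vnorm_ge0 l; move: (vnorm (l - _)) lw.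
move: (vnorm w.1) (vnorm w.2) (vnorm v) (vnorm l) (rinner _ _).
move=> w1 w2 v' l' r s se l'0 v'0 w1l w2w1 rw sr.
have h1 : w2 * v' <= M * (l' + e) * v'.
  by rewrite ler_wpM2r// (le_trans w2w1)// ler_wpM2l.
have h2 : s * l' <= e * l' by rewrite ler_wpM2r.
lra.
Qed.

Lemma represents_linear (W : set (H * K)) c v v' l l' : lin_subspace W ->
  represents W v l -> represents W v' l' ->
  represents W (c *: v + v') (c *: l + l').
Proof.
move=> sW [lW lcl] [lW' lcl']; split=> [w Ww|e e0].
  rewrite !rinnerDr !rinnerZr_conj lW'//; congr (_ + _).
  by rewrite (lW (Num.conj c *: w))//; exact: lin_subspaceZ.
have [d d0 dP] := vnorm_comb_small (H := H) c e0.
have [[w Ww lw] [w' Ww' lw']] := (lcl _ d0, lcl' _ d0).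
exists (c *: w + w'); first by case: sW => _; apply.
by rewrite /= opprD addrACA -scalerBr; exact: dP.
Qed.

Lemma represents_unique (W : set (H * K)) v l l' : lin_subspace W ->
  represents W v l -> represents W v l' -> l = l'.
Proof.
move=> sW lP lP'; apply/eqP; rewrite eq_sym -subr_eq0; apply/eqP.
have := @represents_linear _ (-1) _ _ _ _ sW lP lP'.
rewrite !scaleN1r addNr addrC => [[dW dcl]].
apply: vnorm0_eq0; apply/eqP.
rewrite -sqrf_eq0 eq_le sqr_ge0 andbT.
apply: (@le_of_le_eps R _ _ (vnorm (l' - l))); first exact: vnorm_ge0.
move=> e /dcl[w Ww lw]; rewrite add0r -rinner_self.
rewrite -[X in rinner X _](subrK w.1) rinnerDl dW// rinner0r addr0.
by rewrite (le_trans (rinner_le _ _))// ler_wpM2r// vnorm_ge0.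
Qed.

(** This contains the existence of adjoints (for the graph of an operator) and of
    orthogonal projections (for a subspace of the diagonal). *)
Theorem relation_adjoint (W : set (H * K)) (M : R) :
  0 <= M -> lin_subspace W -> (forall w, W w -> vnorm w.2 <= M * vnorm w.1) ->
  exists y : 'L(K, H),
    forall v, represents W v (y v) /\ vnorm (y v) <= M * vnorm v.
Proof.
move=> M0 sW WM.
have /choice[y yP] := fun v => represents_exists v sW WM.
have yM v : vnorm (y v) <= M * vnorm v by exact: represents_le WM (yP v).
have yL : y \in @bounded_linear R K H.
  apply/asboolP; split=> [c u v|].
    by apply: represents_unique (yP _) _ => //; exact: represents_linear.
  by exists M%:C%C => u; rewrite !normE -rmorphM lecR.
by exists (BoundedOp yL) => v; split.
Qed.

End LinearRelation.

(** * Bounded operators and their adjoints *)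

Section Operators.
Context {R : realType} {H K : hilbertType R}.
Implicit Types (x y : 'L(H, K)) (u v : H).

Lemma op_linear x : linear x.
Proof. by case: x => f /= /asboolP[]. Qed.

Lemma opD x u v : x (u + v) = x u + x v.
Proof. by have := op_linear x 1 u v; rewrite !scale1r. Qed.

Lemma op0 x : x 0 = 0.
Proof. by apply: (addrI (x 0)); rewrite -opD !addr0. Qed.

Lemma opZ x c u : x (c *: u) = c *: x u.
Proof. by have := op_linear x c u 0; rewrite op0 !addr0. Qed.

Lemma opB x u v : x (u - v) = x u - x v.
Proof. by rewrite -scaleN1r opD opZ scaleN1r. Qed.

Lemma op_ext x y : x =1 y -> x = y.
Proof. by move=> xy; apply/val_inj/funext. Qed.

Lemma op_addE x y u : (x + y) u = x u + y u.
Proof. by []. Qed.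

Lemma op_scaleE c x u : (c *: x) u = c *: x u.
Proof. by []. Qed.

Lemma op_bounded x :
  exists2 M : R, 0 <= M & forall u, vnorm (x u) <= M * vnorm u.
Proof.
case: x => f /= /asboolP[fl [M fM]]; exists `|complex.Re M| => // u.
have := fM u; rewrite !normE lecE => /andP[_].
case: M {fM} => a b /=; rewrite mulr0 subr0 => /le_trans; apply.
by rewrite ler_wpM2r ?vnorm_ge0// ler_norm.
Qed.

Lemma opnorm_set_bounded x :
  has_sup [set complex.Re `|x u| | u in [set u : H | `|u| <= 1]].
Proof.
split; first by exists (vnorm (x 0)), 0 => //=; rewrite normr0.
have [M M0 xM] := op_bounded x; exists M => _ [u /= u1 <-].
apply: le_trans (xM u) _; rewrite ler_piMr//.
by rewrite -lecR -normE.
Qed.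

Lemma opnorm_ge0 x : 0 <= opnorm x.
Proof.
apply: le_trans (vnorm_ge0 (x 0)) _.
apply: sup_ubound; first by case: (opnorm_set_bounded x).
by exists 0 => //=; rewrite normr0.
Qed.

Lemma le_opnorm x u : vnorm (x u) <= opnorm x * vnorm u.
Proof.
have [/vnorm0_eq0 ->|u0] := eqVneq (vnorm u) 0.
  by rewrite op0 !vnorm0 mulr0.
have {}u0 : 0 < vnorm u by rewrite lt_def u0 vnorm_ge0.
rewrite -ler_pdivrMr//; apply: sup_ubound.
  by case: (opnorm_set_bounded x).
have c0 : `|((vnorm u)^-1)%:C%C : R[i]| = ((vnorm u)^-1)%:C%C.
  by rewrite ger0_norm// ler0c invr_ge0 ltW.
exists ((vnorm u)^-1%:C%C *: u) => /=.
  by rewrite normrZ c0 normE -rmorphM mulVf ?gt_eqF.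
by rewrite opZ normrZ c0 normE -rmorphM /= mulrC.
Qed.

Lemma opnorm_le x M :
  0 <= M -> (forall u, vnorm (x u) <= M * vnorm u) -> opnorm x <= M.
Proof.
move=> M0 xM; apply: ge_sup; first by case: (opnorm_set_bounded x).
move=> _ [u /= u1 <-]; apply: le_trans (xM u) _.
by rewrite ler_piMr// -lecR -normE.
Qed.

End Operators.

Section Adjoint.
Context {R : realType}.
Implicit Types H K G : hilbertType R.

(** The graph of x is a bounded linear relation, whose adjoint is that of x. *)
Lemma adj_exists H K (x : 'L(H, K)) :
  exists y : 'L(K, H), forall u v, inner (x u) v = inner u (y v).
Proof.
have [M M0 xM] := op_bounded x.
pose W := [set w : H * K | w.2 = x w.1].
have sW : lin_subspace W.
  split; first exact: esym (op0 x); move=> c a b.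
  by rewrite /W /= => -> ->; rewrite opD opZ.
have [|y yW] := relation_adjoint M0 sW; first by move=> [u v]; rewrite /W /= => ->.
exists y => u v; apply: ip_of_rinner => [c|{}u]; first exact: opZ.
have [[yv _] _] := yW v.
by have := yv (u, x u) erefl.
Qed.

Lemma rinner_adj H K (x : 'L(H, K)) u v : rinner (x u) v = rinner u (adj x v).
Proof.
have [y yP] := adj_exists x.
rewrite /rinner; congr complex.Re.
exact: (@xgetPex _ 0 [set y : 'L(K, H) | forall u v, inner (x u) v = inner u (y v)]
  (ex_intro _ y yP) u v).
Qed.

Lemma adj_unique H K (x : 'L(H, K)) (y : 'L(K, H)) :
  (forall u v, rinner (x u) v = rinner u (y v)) -> adj x = y.
Proof.
by move=> xy; apply: op_ext => v; apply: rinner_eqP => u; rewrite -rinner_adj.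
Qed.

Lemma adj_adj H K (x : 'L(H, K)) : adj (adj x) = x.
Proof. by apply: adj_unique => u v; rewrite rinnerC -rinner_adj rinnerC. Qed.

(** |x^* v|^2 = <x x^* v, v> <= M |x^* v| |v|. *)
Lemma adj_le H K (x : 'L(H, K)) (M : R) :
  0 <= M -> (forall u, vnorm (x u) <= M * vnorm u) ->
  forall v, vnorm (adj x v) <= M * vnorm v.
Proof.
move=> M0 xM v; have [->|xv0] := eqVneq (vnorm (adj x v)) 0.
  by rewrite mulr_ge0 ?vnorm_ge0.
have {}xv0 : 0 < vnorm (adj x v) by rewrite lt_def xv0 vnorm_ge0.
rewrite -(ler_pM2r xv0) -expr2 -rinner_self -rinner_adj.
apply: le_trans (rinner_le _ _) _.
by rewrite mulrAC ler_wpM2r ?vnorm_ge0.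
Qed.

Lemma adj0 H K : adj (0 : 'L(H, K)) = 0.
Proof.
apply: adj_unique => u v.
by rewrite -[(0 : 'L(H, K)) u]/(0 : K) -[(0 : 'L(K, H)) v]/(0 : H) rinner0l rinner0r.
Qed.

Lemma adj_comp H K G (x : 'L(K, G)) (y : 'L(H, K)) :
  adj (x \oL y) = adj y \oL adj x.
Proof. by apply: adj_unique => u v /=; rewrite !rinner_adj. Qed.

Lemma adj_add H K (x y : 'L(H, K)) : adj (x + y) = adj x + adj y.
Proof.
by apply: adj_unique => u v; rewrite !op_addE rinnerDl rinnerDr !rinner_adj.
Qed.

Lemma adj_scale H K c (x : 'L(H, K)) : adj (c *: x) = Num.conj c *: adj x.
Proof.
apply: adj_unique => u v; rewrite !op_scaleE rinnerZr_conj conjCK.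
by rewrite -opZ rinner_adj.
Qed.

End Adjoint.

Section Compositions.
Context {R : realType} {H K G : hilbertType R}.

Lemma op_compDl (x y : 'L(K, G)) (z : 'L(H, K)) :
  (x + y) \oL z = x \oL z + y \oL z.
Proof. exact: op_ext. Qed.

Lemma op_compZl c (x : 'L(K, G)) (z : 'L(H, K)) :
  (c *: x) \oL z = c *: (x \oL z).
Proof. exact: op_ext. Qed.

Lemma op_compDr (x : 'L(K, G)) (y z : 'L(H, K)) :
  x \oL (y + z) = x \oL y + x \oL z.
Proof. by apply: op_ext => u; exact: (opD x (y u) (z u)). Qed.

Lemma op_compZr c (x : 'L(K, G)) (z : 'L(H, K)) :
  x \oL (c *: z) = c *: (x \oL z).
Proof. by apply: op_ext => u; exact: (opZ x c (z u)). Qed.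

Lemma op_compA (G' : hilbertType R) (x : 'L(G, G')) (y : 'L(K, G))
  (z : 'L(H, K)) : x \oL (y \oL z) = x \oL y \oL z.
Proof. exact: op_ext. Qed.

End Compositions.

(** * Linear spans and the weak operator topology *)

Section Span.
Context {R : realType} {V : lmodType R[i]}.
Implicit Types S W : set V.

Lemma subset_lspan S : S `<=` lspan S.
Proof.
move=> a Sa; exists 1%N, (fun=> 1), (fun=> a); split=> //.
by rewrite big_ord1 scale1r.
Qed.

Lemma lspan_min S W : lin_subspace W -> S `<=` W -> lspan S `<=` W.
Proof.
move=> sW SW _ [n [c [e [Se ->]]]]; elim/big_ind: _ => [|a b|i _].
- by case: sW.
- exact: lin_subspaceD.
- by apply: lin_subspaceZ => //; exact: SW.
Qed.

Lemma subspace_lspan S : lin_subspace (lspan S).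
Proof.
split; first by exists 0%N, (fun=> 0), (fun=> 0); split=> [[]|]; rewrite ?big_ord0.
move=> k _ _ [n [c [e [Se ->]]]] [m [d [g [Sg ->]]]].
exists (n + m)%N, (fun i => match fintype.split i with inl j => k * c j | inr j => d j end),
  (fun i => match fintype.split i with inl j => e j | inr j => g j end).
split; first by move=> i; case: fintype.split.
rewrite big_split_ord /= scaler_sumr; congr (_ + _); apply: eq_bigr => i _.
  have -> : fintype.split (lshift m i) = inl i by exact: (unsplitK (inl i)).
  by rewrite scalerA.
by have -> : fintype.split (rshift n i) = inr i by exact: (unsplitK (inr i)).
Qed.

End Span.

Section WeakOperatorTopology.
Context {R : realType} {H K : hilbertType R}.

Lemma wot_cvg_coef (F : set_system 'L(H, K)) (z : 'L(H, K)) : Filter F ->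
  cvg_to F (@nbhs _ (wot H K) z) <->
  forall p, wot_coef s p @[s --> F] --> (wot_coef z p : R[i]^o).
Proof.
move=> FF; split=> [Fz p|Fz].
  have /cvg_sup/(_ p) Gz : @wot_coef R H K @ F --> wot_coef z.
    exact: cvg_trans (cvg_app _ Fz) (@initial_continuous _ _ _ z).
  exact: cvg_trans (cvg_app _ Gz) (@initial_continuous _ _ _ (wot_coef z)).
move=> A; rewrite /= nbhsE => -[_ [[C Cop <-] Cz] CA].
apply: (filterS CA).
have Gz : @wot_coef R H K @ F --> wot_coef z.
  apply/cvg_sup => p B /= [_ [[D Dop <-] Dz DB]].
  by apply: (filterS DB); apply: (Fz p); apply: open_nbhs_nbhs.
by apply: Gz; apply: open_nbhs_nbhs.
Qed.

Lemma norm_le_Re_Im (a : R[i]) :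
  `|a| <= (`|complex.Re a| + `|complex.Im a|)%:C%C.
Proof.
rewrite [a in X in X <= _]complexE rmorphD /= (le_trans (ler_normD _ _))//.
rewrite normrM !normc_def /= !expr0n expr1n /= !addr0 add0r sqrtr1 mul1r.
by rewrite !sqrtr_sqr.
Qed.

(** Weak convergence may be tested on real parts, as the imaginary part of
    <s u, v> is up to sign the real part of <s (iu), v>. *)
Lemma wot_cvgP (F : set_system 'L(H, K)) (z : 'L(H, K)) : Filter F ->
  cvg_to F (@nbhs _ (wot H K) z) <->
  forall u v (e : R), 0 < e -> F [set s | `|rinner (s u - z u) v| < e].
Proof.
move=> FF; apply: iff_trans (wot_cvg_coef z FF) _; split=> Fz.
  move=> u v e e0; have ec0 : 0 < (e%:C%C : R[i]) by rewrite ltcR.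
  have /cvgrPdist_lt/(_ _ ec0) := Fz (u, v).
  apply: filterS => s /= h; rewrite -ltcR; apply: le_lt_trans h.
  rewrite distrC rinnerBl /rinner -[wot_coef s _]/(ip (s u) v).
  rewrite -[wot_coef z _]/(ip (z u) v); apply: le_trans (normc_ge_Re _).
  by rewrite lecR; case: (ip _ _) (ip _ _) => ? ? [? ?] /=.
move=> [u v]; apply/cvgrPdist_lt => e e0.
have [r r0 ->] := gt0_complex_real e0.
have r2 : 0 < r / 2 by rewrite divr_gt0.
apply: filterS2 (Fz u v _ r2) (Fz ('i%C *: u) v _ r2) => s /=.
rewrite !opZ !rinnerBl /rinner !ipZl.
rewrite distrC -[wot_coef s _]/(ip (s u) v) -[wot_coef z _]/(ip (z u) v).
move: (ip (s u) v) (ip (z u) v) => [a b] [a' b'].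
rewrite /= !mul0r !mul1r !sub0r => h1 h2; apply: le_lt_trans (norm_le_Re_Im _) _.
rewrite ltcR /=; move: h1 h2; rewrite -opprD normrN (distrC b); lra.
Qed.

End WeakOperatorTopology.

Section WotClosure.
Context {R : realType} {H K : hilbertType R}.

Lemma wot_spanP (S : set 'L(H, K)) (z : 'L(H, K)) :
  wot_span S z <->
  exists2 F : set_system 'L(H, K), ProperFilter F /\ F (lspan S) &
    forall u v (e : R), 0 < e -> F [set s | `|rinner (s u - z u) v| < e].
Proof.
rewrite /wot_span closureEcvg; split=> -[F FF].
  move=> [Fz SF]; exists F; last exact/(wot_cvgP z).
  by split=> //; apply: SF.
move=> Fz; case: FF => FF FS; exists F => //; split; first exact/(wot_cvgP z).
by move=> A SA; exact: filterS FS.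
Qed.

End WotClosure.

(** * Corners *)

Section Corner.
Context {R : realType} {H1 H2 : hilbertType R}.
Implicit Types (E : set 'L(H2, H1)).

Lemma corner_lspan E : vn_corner E -> lspan E `<=` E.
Proof. by move=> [EE _]; rewrite [X in _ `<=` X]EE; exact: (@subset_closure (wot H2 H1)). Qed.

Lemma corner_subspace E : vn_corner E -> lin_subspace E.
Proof.
move=> cE; have [W0 WD] := subspace_lspan E.
split; first exact: corner_lspan cE _ W0.
by move=> c a b Ea Eb; apply: (corner_lspan cE); apply: WD; exact: subset_lspan.
Qed.

Lemma corner_triple E x y z :
  vn_corner E -> E x -> E y -> E z -> E (x \oL adj y \oL z).
Proof.
move=> [_ sE] Ex Ey Ez; apply: sE; exists (x \oL adj y); last by exists z.
by exists x => //; exists (adj y) => //; exists y.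
Qed.

Lemma corner_alg_gram E v x : E v -> E x -> corner_alg E (adj v \oL x).
Proof.
move=> Ev Ex; apply: (@subset_closure (wot H2 H2)); apply: subset_lspan.
by exists (adj v); [exists v|exists x].
Qed.

(** The map z |-> x z^* is weakly continuous and sends a^* b to x b^* a, which
    belongs to E E^* E. *)
Lemma corner_comp_adj E x z :
  vn_corner E -> E x -> corner_alg E z -> E (x \oL adj z).
Proof.
move=> cE Ex /wot_spanP[F [FF FS] Fz].
have [E0 ED] := corner_subspace cE.
have xE : lspan (set_comp (set_adj E) E) `<=` [set s | E (x \oL adj s)].
  apply: lspan_min; last first.
    move=> _ [_ [a Ea <-] [b Eb <-]] /=.
    by rewrite adj_comp adj_adj op_compA; exact: corner_triple.
  split=> [|c a b Ea Eb] /=; last first.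
    by rewrite adj_add adj_scale op_compDr op_compZr; exact: ED.
  rewrite adj0.
  have -> : x \oL (0 : 'L(H2, H2)) = 0 :> 'L(H2, H1); last exact: E0.
  by apply: op_ext => u; exact: (op0 x).
rewrite (proj1 cE); apply/wot_spanP.
exists ((fun s => x \oL adj s) @ F); first split.
- exact: fmap_proper_filter.
- change (F [set s | lspan E (x \oL adj s)]).
  by apply: (filterS _ FS) => s /xE /=; exact: subset_lspan.
- move=> u v e e0.
  have xt t : rinner ((x \oL adj t) u) v = rinner (t (adj x v)) u.
    by rewrite [RHS]rinner_adj [RHS]rinnerC -rinner_adj.
  change (F [set s | `|rinner ((x \oL adj s) u - (x \oL adj z) u) v| < e]).
  apply: filterS (Fz (adj x v) u _ e0) => s.
  by rewrite /mkset !rinnerBl !xt.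
Qed.

End Corner.

(** * Powers of 1 - h for a positive contraction h *)

Section ComplementPowers.
Context {R : realType} {H G : hilbertType R}.
Variable h : 'L(H, H).
Hypothesis hsa : forall u v, rinner (h u) v = rinner u (h v).
(* for selfadjoint h this inequality says that 0 <= h <= 1 *)
Hypothesis hfn : forall v, vnorm (h v) ^+ 2 <= rinner (h v) v.

Definition compl_pow m : 'L(H, H) := iter m (op_comp (op1 H - h)) (op1 H).

Lemma compl_powS m v : compl_pow m.+1 v = compl_pow m v - h (compl_pow m v).
Proof. by []. Qed.

Lemma compl_pow_comm m v : h (compl_pow m v) = compl_pow m (h v).
Proof. by elim: m => // m IH; rewrite !compl_powS opB IH. Qed.

Lemma compl_pow_sa m u v : rinner (compl_pow m u) v = rinner u (compl_pow m v).
Proof.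
elim: m u v => // m IH u v.
by rewrite !compl_powS rinnerBl rinnerBr hsa !IH compl_pow_comm.
Qed.

(** Write Q(w) = <h w, w> and k = 1 - h.  The induction step consists of
    Q(w) <= |w|^2 - |k w|^2 and Q(k w) <= Q(w) - |h w|^2 <= Q(w). *)
Lemma compl_pow_decay m v :
  m%:R * rinner (h (compl_pow m v)) (compl_pow m v) + vnorm (compl_pow m v) ^+ 2
  <= vnorm v ^+ 2.
Proof.
elim: m => [|m IH]; first by rewrite mul0r add0r.
apply: le_trans IH; rewrite compl_powS; move: (compl_pow m v) => w.
have h1 := hfn w.
have h3 : rinner (h (h w)) (h w) <= vnorm (h w) ^+ 2.
  have := hfn (h w); have := rinner_le (h (h w)) (h w).
  have := vnorm_ge0 (h w); have := vnorm_ge0 (h (h w)).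
  move: (rinner _ _) (vnorm _) (vnorm _) => q a b a0 b0 qab aq.
  have ab : b <= a by nra.
  by apply: le_trans qab _; rewrite expr2 ler_wpM2r.
have Qk : rinner (h (w - h w)) (w - h w) <= rinner (h w) w - vnorm (h w) ^+ 2.
  rewrite opB rinnerBl !rinnerBr (hsa (h w) w) !rinner_self; lra.
have Qk' : rinner (h (w - h w)) (w - h w) <= rinner (h w) w.
  by apply: le_trans Qk _; rewrite lerBlDr lerDl sqr_ge0.
have {}Qk' := ler_wpM2l (ler0n R m) Qk'.
rewrite -natr1 mulrDl mul1r vnormB_sqr (rinnerC w).
have := sqr_ge0 (vnorm (h w)); lra.
Qed.

Lemma energy_ge0 v : 0 <= rinner (h v) v.
Proof. exact: le_trans (sqr_ge0 _) (hfn v). Qed.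

Lemma compl_pow_energy m v : m%:R * rinner (h (compl_pow m v)) (compl_pow m v) <= vnorm v ^+ 2.
Proof. by apply: le_trans (compl_pow_decay m v); rewrite lerDl sqr_ge0. Qed.

Lemma compl_pow_contract m v : vnorm (compl_pow m v) <= vnorm v.
Proof.
rewrite -(@ler_pXn2r _ 2)// ?nnegrE ?vnorm_ge0//.
by apply: le_trans (compl_pow_decay m v); rewrite lerDr mulr_ge0// energy_ge0.
Qed.

(** By [compl_pow_energy], |x^* k^m v|^2 <= N <h k^m v, k^m v> <= (N / m) |v|^2. *)
Lemma compl_pow_comp_small (x : 'L(G, H)) (N d : R) m : 0 <= N -> 0 <= d ->
  (forall v, vnorm (adj x v) ^+ 2 <= N * rinner (h v) v) ->
  N <= m%:R * d ^+ 2 -> opnorm (compl_pow m \oL x) <= d.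
Proof.
move=> N0 d0 xN Nm; apply: opnorm_le => // w.
rewrite -[compl_pow m \oL x]adj_adj; apply: adj_le => // {}w.
rewrite adj_comp; have -> : adj (compl_pow m) = compl_pow m.
  by apply: adj_unique => u v; exact: compl_pow_sa.
rewrite -[(adj x \oL compl_pow m) w]/(adj x (compl_pow m w)).
rewrite -(@ler_pXn2r _ 2)// ?nnegrE ?(mulr_ge0 d0) ?vnorm_ge0//.
apply: le_trans (xN _) _; rewrite exprMn.
apply: le_trans (ler_wpM2r (energy_ge0 _) Nm) _.
by rewrite (mulrC m%:R) -mulrA ler_wpM2l ?sqr_ge0// compl_pow_energy.
Qed.

End ComplementPowers.

(** * Approximation of a bounded module map *)

Section ModuleMap.
Context {R : realType} {H1 H2 : hilbertType R}.
Variables (E : set 'L(H2, H1)) (f : 'L(H2, H1) -> 'L(H2, H2)) (C : R).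
Hypothesis cE : vn_corner E.
Hypothesis fE : forall x, E x -> corner_alg E (f x).
Hypothesis flin : linear_on E f.
Hypothesis fmod : forall x z, E x -> corner_alg E z -> f (x \oL z) = f x \oL z.
Hypothesis C0 : 0 < C.
Hypothesis fC : forall x, E x -> opnorm (f x) <= C * opnorm x.

Let sE : lin_subspace E := corner_subspace cE.

Lemma module_mapD x y : E x -> E y -> f (x + y) = f x + f y.
Proof. by move=> Ex Ey; have := flin 1 Ex Ey; rewrite !scale1r. Qed.

Lemma module_map0 : f 0 = 0.
Proof.
have E0 : E 0 by case: sE.
by apply: (addrI (f 0)); rewrite -module_mapD// !addr0.
Qed.

Lemma module_mapZ c x : E x -> f (c *: x) = c *: f x.
Proof.
move=> Ex; have E0 : E 0 by case: sE.
by have := flin c Ex E0; rewrite module_map0 !addr0.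
Qed.

Lemma module_mapB x y : E x -> E y -> f (x - y) = f x - f y.
Proof.
move=> Ex Ey; rewrite -scaleN1r module_mapD//; last exact: lin_subspaceZ.
by rewrite module_mapZ// scaleN1r.
Qed.

(** The witnesses are h = sum x x^* and y = sum x f(x)^* over the list [xs]; then
    <h v, v> = sum |x^* v|^2, and f(h z) = sum f(x) x^* z because x^* z is in
    [E^* E]. *)
Lemma finite_energy (xs : seq 'L(H2, H1)) : (forall x, x \in xs -> E x) ->
  exists (h : 'L(H1, H1)) (y : 'L(H2, H1)) (N : R),
  [/\ 0 < N /\ (forall v, vnorm (h v) ^+ 2 <= N * rinner (h v) v),
      forall u v, rinner (h u) v = rinner u (h v),
      forall x v, x \in xs -> vnorm (adj x v) ^+ 2 <= rinner (h v) v,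
      E y &
      forall z, E z -> E (h \oL z) /\ f (h \oL z) = adj y \oL z].
Proof.
elim: xs => [_|x xs IH xxsE].
  exists 0, 0, 1; split=> //.
  - split=> // v; rewrite -[(0 : 'L(H1, H1)) v]/(0 : H1).
    by rewrite vnorm0 rinner0l expr0n mulr0.
  - move=> u v; rewrite -[(0 : 'L(H1, H1)) u]/(0 : H1).
    by rewrite -[(0 : 'L(H1, H1)) v]/(0 : H1) rinner0l rinner0r.
  - by case: sE.
  - move=> z Ez; have -> : (0 : 'L(H1, H1)) \oL z = 0 by exact: op_ext.
    split; first by case: sE.
    rewrite module_map0.
    by rewrite adj0; exact: op_ext.
have Ex : E x by apply: xxsE; rewrite mem_head.
have [|h [y [N [[N0 hN] hsa hx Ey hE]]]] := IH.
  by move=> z zxs; apply: xxsE; rewrite in_cons zxs orbT.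
have [M M0 xM] := op_bounded x.
have hvE v : (h + x \oL adj x) v = h v + x (adj x v) by [].
have xx u v : rinner (x (adj x u)) v = rinner (adj x u) (adj x v).
  by rewrite rinner_adj.
exists (h + x \oL adj x), (y + x \oL adj (f x)), (2 * (N + M ^+ 2)).
split.
- split=> [|v]; first by rewrite mulr_gt0// ltr_pwDl// sqr_ge0.
  rewrite hvE rinnerDl xx rinner_self.
  have hv := hN v.
  have h0 : 0 <= rinner (h v) v.
    by rewrite -(pmulr_rge0 _ N0); exact: le_trans (sqr_ge0 _) hv.
  have xv : vnorm (x (adj x v)) ^+ 2 <= M ^+ 2 * vnorm (adj x v) ^+ 2.
    by rewrite -exprMn lerXn2r ?nnegrE ?mulr_ge0 ?vnorm_ge0.
  rewrite vnormD_sqr.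
  have := sqr_ge0 (vnorm (h v - x (adj x v))); rewrite vnormB_sqr.
  have p1 : 0 <= M ^+ 2 * rinner (h v) v by rewrite mulr_ge0// sqr_ge0.
  have p2 : 0 <= N * vnorm (adj x v) ^+ 2 by rewrite mulr_ge0 ?sqr_ge0// ltW.
  lra.
- by move=> u v; rewrite !hvE rinnerDl rinnerDr hsa xx [in RHS](rinnerC u (x _)) xx
    (rinnerC (adj x v)).
- move=> z v; rewrite in_cons hvE rinnerDl xx rinner_self => /orP[/eqP ->|zxs].
    rewrite lerDr -(pmulr_rge0 _ N0); exact: le_trans (sqr_ge0 _) (hN v).
  by apply: le_trans (hx _ _ zxs) _; rewrite lerDl sqr_ge0.
- by apply: lin_subspaceD => //; apply: corner_comp_adj => //; exact: fE.
- move=> z Ez; have [Ehz fhz] := hE _ Ez.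
  have Exz : E (x \oL adj x \oL z) by exact: corner_triple.
  rewrite op_compDl; split; first exact: lin_subspaceD.
  rewrite module_mapD// fhz -op_compA fmod//; last exact: corner_alg_gram.
  by rewrite adj_add adj_comp adj_adj op_compDl op_compA.
Qed.

(** With k = 1 - h, the representing operators are e_0 = 0 and
    e_(m+1) = e_m + k^m y1, as f(h k^m z) = y1^* k^m z = (k^m y1)^* z. *)
Lemma module_map_compl_pow (h : 'L(H1, H1)) (y1 : 'L(H2, H1)) m :
  (forall u v, rinner (h u) v = rinner u (h v)) -> E y1 ->
  (forall z, E z -> E (h \oL z) /\ f (h \oL z) = adj y1 \oL z) ->
  exists2 y, E y & forall z, E z ->
    E (compl_pow h m \oL z) /\ f (compl_pow h m \oL z) = f z - adj y \oL z.
Proof.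
move=> hsa Ey1 hE; elim: m => [|m [y Em mE]].
  exists 0; first by case: sE.
  move=> z Ez; have -> : compl_pow h 0 \oL z = z by exact: op_ext.
  split=> //; rewrite adj0.
  have -> : (0 : 'L(H1, H2)) \oL z = 0 by exact: op_ext.
  by rewrite subr0.
exists (y + compl_pow h m \oL y1).
  by apply: lin_subspaceD => //; case: (mE _ Ey1).
move=> z Ez; have [Emz fmz] := mE _ Ez; have [Ehmz fhmz] := hE _ Emz.
have -> : compl_pow h m.+1 \oL z = compl_pow h m \oL z - h \oL (compl_pow h m \oL z).
  exact: op_ext.
split; first by rewrite -scaleN1r addrC; case: sE => _; apply.
rewrite module_mapB// fmz fhmz adj_add adj_comp.
have -> : adj (compl_pow h m) = compl_pow h m.
  by apply: adj_unique => u v; exact: compl_pow_sa.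
by rewrite op_compDl opprD addrA op_compA.
Qed.

(** As y^* y = f(y - g y), the C^*-identity gives |y|^2 <= 2 C |y|. *)
Lemma represented_norm_le (g : 'L(H1, H1)) (y : 'L(H2, H1)) :
  (forall v, vnorm (g v) <= vnorm v) -> E y -> E (g \oL y) ->
  f (g \oL y) = f y - adj y \oL y -> opnorm y <= 2 * C.
Proof.
move=> g1 Ey Egy fgy.
have yy : adj y \oL y = f (y - g \oL y).
  by rewrite module_mapB// fgy opprB addrCA subrr addr0.
have le1 : opnorm (y - g \oL y) <= 2 * opnorm y.
  apply: opnorm_le => [|u]; first by rewrite mulr_ge0// opnorm_ge0.
  apply: le_trans (vnormD _ _) _; rewrite vnormN.
  have := g1 (y u); have := le_opnorm y u.
  by move=> a b; rewrite -mulrA mulrDl mul1r lerD// (le_trans b).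
have oy v : vnorm (y v) ^+ 2 <= 2 * C * opnorm y * vnorm v ^+ 2.
  rewrite -rinner_self rinner_adj -[adj y (y v)]/((adj y \oL y) v) yy.
  apply: le_trans (rinner_le _ _) _.
  have Ed : E (y - g \oL y) by rewrite -scaleN1r addrC; case: sE => _; apply.
  have := le_opnorm (f (y - g \oL y)) v; have := fC Ed.
  have := vnorm_ge0 v; have := opnorm_ge0 y.
  have := ler_wpM2l (ltW C0) le1.
  move: (vnorm (f _ _)) (opnorm (f _)) (opnorm _) => a b c d o0 v0 bc av.
  rewrite mulrC expr2 mulrA ler_wpM2r// (le_trans av)// ler_wpM2r//.
  by lra.
have o0 := opnorm_ge0 y; have C2 : 0 <= 2 * C by rewrite mulr_ge0// ltW.
have : opnorm y <= Num.sqrt (2 * C * opnorm y).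
  apply: opnorm_le => [|v]; first exact: sqrtr_ge0.
  rewrite -(@ler_pXn2r _ 2)// ?nnegrE ?mulr_ge0 ?sqrtr_ge0 ?vnorm_ge0//.
  by rewrite exprMn sqr_sqrtr// mulr_ge0.
rewrite -(@ler_pXn2r _ 2)// ?nnegrE ?sqrtr_ge0// sqr_sqrtr ?(mulr_ge0 C2 o0)//.
have [->|n0] := eqVneq (opnorm y) 0; first by [].
by rewrite expr2 ler_pM2r// lt_def n0.
Qed.

Lemma module_map_approx (xs : seq 'L(H2, H1)) (e : R) :
  (forall x, x \in xs -> E x) -> 0 < e ->
  exists y, [/\ E y, forall v, vnorm (y v) <= 2 * C * vnorm v &
    forall x v, x \in xs -> vnorm (f x v - adj y (x v)) <= e * vnorm v].
Proof.
move=> xsE e0; have [h0 [y0 [N [[N0 hN] hsa hx Ey hE]]]] := finite_energy xsE.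
pose h : 'L(H1, H1) := (N^-1)%:C%C *: h0.
have hvE v : h v = (N^-1)%:C%C *: h0 v by [].
have hsa' u v : rinner (h u) v = rinner u (h v).
  by rewrite !hvE rinnerZl rinnerZr hsa.
have hfn v : vnorm (h v) ^+ 2 <= rinner (h v) v.
  rewrite -rinner_self !hvE rinnerZl rinnerZr rinnerZl rinner_self.
  by rewrite ler_pM2l ?invr_gt0// mulrC ler_pdivrMr// mulrC.
have hx' x : x \in xs -> forall v, vnorm (adj x v) ^+ 2 <= N * rinner (h v) v.
  move=> xxs v; rewrite hvE rinnerZl mulrA mulfV ?gt_eqF// mul1r.
  exact: hx.
pose y1 : 'L(H2, H1) := (N^-1)%:C%C *: y0.
have Ey1 : E y1 by exact: lin_subspaceZ.
have cN : Num.conj ((N^-1)%:C%C : R[i]) = (N^-1)%:C%C by exact: conjc_real.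
have hE' z : E z -> E (h \oL z) /\ f (h \oL z) = adj y1 \oL z.
  move=> /hE[Ehz fhz]; rewrite op_compZl; split; first exact: lin_subspaceZ.
  by rewrite module_mapZ// fhz adj_scale cN op_compZl.
have eC : 0 < e / C by rewrite divr_gt0.
have [m Nm] : exists m : nat, N <= m%:R * (e / C) ^+ 2.
  exists (Num.bound (N / (e / C) ^+ 2)).
  rewrite -ler_pdivrMr ?exprn_gt0//; apply: ltW (archi_boundP _).
  by rewrite divr_ge0 ?sqr_ge0// ltW.
have [y Ey2 yE] := module_map_compl_pow m hsa' Ey1 hE'.
exists y; split=> //.
  have [Emy fmy] := yE _ Ey2.
  have yo := represented_norm_le (compl_pow_contract hsa' hfn m) Ey2 Emy fmy.
  by move=> v; apply: le_trans (le_opnorm y v) _; rewrite ler_wpM2r// vnorm_ge0.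
move=> x v xxs; have [Emx fmx] := yE _ (xsE _ xxs).
have omx := compl_pow_comp_small hsa' hfn (ltW N0) (ltW eC) (hx' _ xxs) Nm.
have -> : f x v - adj y (x v) = (f (compl_pow h m \oL x)) v by rewrite fmx.
apply: le_trans (le_opnorm _ _) _; rewrite ler_wpM2r ?vnorm_ge0//.
apply: le_trans (fC Emx) _.
by rewrite mulrC -ler_pdivlMr.
Qed.

End ModuleMap.

(** * Representation of a map with uniformly bounded approximants *)

Section Representation.
Context {R : realType} {H1 H2 : hilbertType R}.
Variables (E : set 'L(H2, H1)) (f : 'L(H2, H1) -> 'L(H2, H2)) (M : R).
Hypothesis cE : vn_corner E.
Hypothesis M0 : 0 <= M.

Definition approximants (xs : seq 'L(H2, H1)) (e : R) : set 'L(H2, H1) :=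
  [set y | [/\ E y, forall v, vnorm (y v) <= M * vnorm v &
    forall x v, x \in xs -> vnorm (f x v - adj y (x v)) <= e * vnorm v]].

Hypothesis fapprox : forall xs e, (forall x, x \in xs -> E x) -> 0 < e ->
  approximants xs e !=set0.

(** The net of approximants, indexed by finite subsets of [E] and accuracies. *)
Definition approx_filter : set_system 'L(H2, H1) :=
  filter_from [set p : seq 'L(H2, H1) * R | (forall x, x \in p.1 -> E x) /\ 0 < p.2]
    (fun p => approximants p.1 p.2).

Lemma approx_filter_proper : ProperFilter approx_filter.
Proof.
apply: filter_from_proper => [|[xs e] [/= xsE e0]]; last exact: fapprox.
apply: filter_from_filter; first by exists ([::], 1).
move=> [xs e] [ys d] [/= xsE e0] [/= ysE d0].
exists (xs ++ ys, Num.min e d) => /=.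
  split=> [x|]; last by rewrite lt_min e0 d0.
  by rewrite mem_cat => /orP[/xsE|/ysE].
move=> y [Ey yM yf]; split; split=> // x v xxs.
  have xi : x \in xs ++ ys by rewrite mem_cat xxs.
  by apply: le_trans (yf _ v xi) _; rewrite ler_wpM2r ?vnorm_ge0// ge_min lexx.
have xi : x \in xs ++ ys by rewrite mem_cat xxs orbT.
by apply: le_trans (yf _ v xi) _; rewrite ler_wpM2r ?vnorm_ge0// ge_min lexx orbT.
Qed.

Local Instance approx_filter_filter : ProperFilter approx_filter :=
  approx_filter_proper.

(** The graph of the operator x v |-> f(x) v on the span of E H2, before it is
    known to be single-valued. *)
Definition module_graph : set (H1 * H2) :=
  lspan [set w | exists2 x, E x & exists v, w = (x v, f x v)].

Lemma module_graph_approx w (e : R) : module_graph w -> 0 < e ->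
  approx_filter [set y | vnorm (w.2 - adj y w.1) <= e].
Proof.
move=> Ww; move: w Ww e.
apply: (@lspan_min _ _ _ [set w : H1 * H2 | forall e : R, 0 < e ->
  approx_filter [set y | vnorm (w.2 - adj y w.1) <= e]]).
  split=> [e e0|c a b aF bF e e0].
    apply: filterS filterT => y _ /=.
    by rewrite op0 subrr vnorm0 ltW.
  have [d d0 dP] := vnorm_comb_small (H := H2) c e0.
  apply: filterS2 (aF _ d0) (bF _ d0) => y /= ya yb.
  by rewrite opD opZ opprD addrACA -scalerBr; exact: dP.
move=> _ [x Ex [v ->]] e e0 /=.
have e' : 0 < e / (vnorm v + 1) by rewrite divr_gt0// ltr_wpDl// vnorm_ge0.
exists ([:: x], e / (vnorm v + 1)).
  by split=> //= z; rewrite inE => /eqP->.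
move=> y [_ _ /(_ x v (mem_head _ _))] /= /le_trans; apply.
rewrite mulrAC ler_pdivrMr ?ltr_wpDl ?vnorm_ge0//.
by rewrite ler_wpM2l ?(ltW e0)// lerDl.
Qed.

(** Every approximant y has |y^*| <= M, and some y^* w.1 is as close to w.2 as
    desired. *)
Lemma module_graph_bounded w :
  module_graph w -> vnorm w.2 <= M * vnorm w.1.
Proof.
move=> Ww; apply: (@le_of_le_eps R _ _ 1) => // e e0; rewrite mulr1.
have /filter_ex[y [/= wy [_ yM _]]] : approx_filter
    ([set y | vnorm (w.2 - adj y w.1) <= e] `&` approximants [::] 1).
  apply: filterI; first exact: module_graph_approx.
  by exists ([::], 1).
rewrite -[w.2](subrK (adj y w.1)) addrC; apply: le_trans (vnormD _ _) _.
by rewrite lerD// adj_le.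
Qed.

(** The operator y is the adjoint of [module_graph], and the approximants converge
    weakly to it: for a vector v only its projection p v to the closed span of
    E H2 matters, which is approximated by a vector of the span, where
    [module_graph_approx] applies. *)
Theorem module_map_represented :
  exists2 y, E y & forall x, E x -> f x = adj y \oL x.
Proof.
have sW : lin_subspace module_graph := subspace_lspan _.
have [y yP] := relation_adjoint M0 sW module_graph_bounded.
have graphE x v : E x -> module_graph (x v, f x v).
  by move=> Ex; apply: subset_lspan; exists x => //; exists v.
exists y; last first.
  move=> x Ex; apply: op_ext => v; apply: rinner_eqP => u.
  have [[yu _] _] := yP u.
  by rewrite -[(adj y \oL x) v]/(adj y (x v)) -rinner_adj [RHS]rinnerC
     (yu _ (graphE x v Ex)) rinnerC.
(* p is the orthogonal projection onto the closed span of E H2 *)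
pose D := [set w : H1 * H1 | w.1 = w.2 /\ exists b, module_graph (w.1, b)].
have sD : lin_subspace D.
  split; first by split=> //; exists 0; case: sW.
  move=> c [a a'] [b b'] [/= <- [d da]] [/= <- [d' db]]; split=> //.
  by exists (c *: d + d'); case: sW => _ WD; exact: (WD c _ _ da db).
have [|p pP] := relation_adjoint ler01 sD.
  by move=> [a b] [/= -> _]; rewrite mul1r.
have pE a b v : module_graph (a, b) -> rinner a (p v) = rinner a v.
  move=> Wab; have [[pv _] _] := pP v.
  by apply: (pv (a, a)); split=> //; exists b.
have yp u v : rinner (y u) (p v) = rinner (y u) v.
  apply/eqP; rewrite -subr_eq0 -normr_le0 -rinnerBr.
  apply: (@le_of_le_eps R _ _ (vnorm (p v - v))); first exact: vnorm_ge0.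
  move=> e e0; have [[_ yu] _] := yP u.
  have [[a b] Wab yae] := yu _ e0; rewrite add0r.
  rewrite -[y u](subrK a) rinnerDl [X in _ + X]rinnerBr (pE a b)// subrr addr0.
  by apply: le_trans (norm_rinner_le _ _) _; rewrite ler_wpM2r ?vnorm_ge0.
rewrite (proj1 cE); apply/wot_spanP; exists approx_filter.
  split; first exact: approx_filter_proper.
  exists ([::], 1) => // s [Es _ _]; exact: subset_lspan.
move=> u v e e0.
(* the estimate below is B times the accuracy *)
pose B := 2 * M * vnorm u + vnorm u.
have B0 : 0 <= B by rewrite addr_ge0 ?mulr_ge0 ?vnorm_ge0.
have d0 : 0 < e / (B + 1) by rewrite divr_gt0// ltr_wpDl.
have [[_ /(_ _ d0)[[a a'] [_ [b Wab]] pa]] _] := pP v.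
have near1 : approx_filter (approximants [::] 1) by exists ([::], 1).
apply: filterS2 near1 (module_graph_approx Wab d0) => s [Es sM _] /= sb.
have -> : rinner (s u - y u) v =
    rinner (s u - y u) (p v - a) + rinner u (adj s a - b).
  have [[yu _] _] := yP u; have := yu _ Wab => /= yab.
  rewrite !(rinnerBl, rinnerBr) yp (pE _ _ _ (graphE s u Es)).
  by rewrite -(rinner_adj s u a) (rinnerC (y u) a) yab (rinnerC b); ring.
apply: le_lt_trans (ler_normD _ _) _.
have h1 := norm_rinner_le (s u - y u) (p v - a).
have h2 := norm_rinner_le u (adj s a - b).
have h3 : vnorm (s u - y u) <= 2 * M * vnorm u.
  have [_ yM] := yP u.
  apply: le_trans (vnormD _ _) _; rewrite vnormN.
  by have := sM u; lra.
apply: le_lt_trans (lerD h1 h2) _.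
apply: (@le_lt_trans _ _ (B * (e / (B + 1)))).
  rewrite mulrDl lerD//; first by rewrite ler_pM ?vnorm_ge0.
  by rewrite ler_wpM2l ?vnorm_ge0// -vnormN opprB.
by rewrite mulrA ltr_pdivrMr ?ltr_wpDl// mulrC ltr_pM2l// ltrDl.
Qed.

End Representation.

(** * The Riesz lemma *)

Theorem proposition1p9 (R : realType) (K H1 H2 : hilbertType R)
    (A2 : set 'L(K, K)) (E : set 'L(H2, H1))
    (pi2 : 'L(K, K) -> 'L(H2, H2)) (f : 'L(H2, H1) -> 'L(H2, H2)) :
  von_neumann_algebra A2 ->
  hilbert_vn_module A2 E pi2 ->
  (forall x, E x -> corner_alg E (f x)) ->
  linear_on E f ->
  (forall x z, E x -> corner_alg E z ->
    f (x \oL z) = f x \oL z) ->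
  (exists2 C : R, 0 < C & forall x, E x -> opnorm (f x) <= C * opnorm x) ->
  exists2 y, E y & forall x, E x -> f x = adj y \oL x.
Proof.
move=> _ [cE _ _] fE flin fmod [C C0 fC].
have C2 : 0 <= 2 * C by rewrite mulr_ge0// ltW.
apply: (module_map_represented cE C2) => xs e xsE e0.
exact: (module_map_approx cE fE flin fmod C0 fC xsE e0).
Qed.
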